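(* On the Weyl group of $\mathfrak{G}$, the Bruhat ordering implies the primary ordering: for any elements $a,b$ of the Weyl group, $a\prec b$ implies $a\le b$.
   Context: Let $\mathfrak{G}$ be a complex semisimple Lie algebra of rank $n$, with a fixed Cartan subalgebra, root system $\Delta$, positive roots $\Delta^+$, and simple roots $\alpha_1,\dots,\alpha_n$. Identify $\alpha_i$ with the standard basis vector $e_i$ of $\mathbb{R}^n$, so that $\Delta\subset\mathbb{R}^n$ and the Weyl group $MW(\mathfrak{G})$ acts on $\mathbb{R}^n$ by $n\times n$ integer matrices. Let $\delta\in\mathbb{R}^n$ be the half-sum of all positive roots. The map $P(w)=\delta-w\delta$ is a bijection from $MW(\mathfrak{G})$ onto a set $PW(\mathfrak{G})\subset\mathbb{R}^n$, the primary realization of the Weyl group (with the group operation transferred by $P$). The primary ordering $\le$ on the Weyl group is the partial ordering inherited, through this realization, from the componentwise partial order on $\mathbb{R}^n$ ($x\le y$ iff $x_i\le y_i$ for all $i$); that is, $w\le w'$ iff $\delta-w\delta\le\delta-w'\delta$ componentwise. The symbol $\prec$ denotes the Bruhat ordering of the Weyl group as a Coxeter group generated by the simple reflections $s_i=s_{\alpha_i}$. *)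

(* Defs.v *)
From HB Require Import structures.
From mathcomp Require Import all_boot all_order all_algebra.
From mathcomp Require Import mathcomp_extra boolp classical_sets fsbigop reals.
From mathcomp Require Import complex.
From Stdlib Require Import Relation_Operators.

Set Implicit Arguments.
Unset Strict Implicit.
Unset Printing Implicit Defensive.

Import Order.TTheory GRing.Theory Num.Theory.

Local Open Scope ring_scope.
Local Open Scope classical_set_scope.
Local Open Scope complex_scope.

(* A Lie bracket on a finite-dimensional space L is given by its adjoint map
   ad : L -> End(L): ad x y is the bracket of x and y, and its bilinearity is
   carried by the type. *)

Section LieAlgebra.
Variables (K : fieldType) (L : vectType K) (ad : 'Hom(L, 'End(L))).

Definition is_lie_bracket : Prop :=
  (forall x, ad x x = 0) /\
  (forall x y z, ad x (ad y z) + ad y (ad z x) + ad z (ad x y) = 0).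

Definition lie_prod (U V : {vspace L}) : {vspace L} :=
  <<[seq ad x y | x <- vbasis U, y <- vbasis V]>>%VS.

Definition lie_ideal (I : {vspace L}) : Prop :=
  forall x y, y \in I -> ad x y \in I.

Definition lie_solvable (I : {vspace L}) : Prop :=
  exists k, iter k (fun J => lie_prod J J) I = 0%VS.

Definition lie_semisimple : Prop :=
  forall I : {vspace L}, lie_ideal I -> lie_solvable I -> I = 0%VS.

Definition lie_abelian (A : {vspace L}) : Prop :=
  forall x y, x \in A -> y \in A -> ad x y = 0.

Definition lfun_diagonalizable (f : 'End(L)) : Prop :=
  exists2 b : seq L, basis_of fullv b &
    forall v, v \in b -> exists c : K, f v = c *: v.

(* The usual definition for a complex semisimple Lie algebra: a maximal
   abelian subalgebra all of whose elements are ad-semisimple.  Over an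
   algebraically closed field an endomorphism is semisimple iff it is
   diagonalizable. *)
Definition cartan_subalgebra (H : {vspace L}) : Prop :=
  [/\ lie_abelian H,
      forall A : {vspace L}, lie_abelian A -> (H <= A)%VS -> A = H
    & forall h, h \in H -> lfun_diagonalizable (ad h)].

Definition lfun_trace (f : 'End(L)) : K :=
  \tr (passmx.mxof (vbasis {:L}) (vbasis {:L}) f).

Definition killing (x y : L) : K := lfun_trace (ad x \o ad y)%VF.

Section Roots.
Variable H : {vspace L}.

Definition dual := 'Hom(subvs_of H, K^o).

Definition is_root (a : dual) : Prop :=
  a != 0 /\
  exists2 x : L, x != 0 & forall h : subvs_of H, ad (vsval h) x = a h *: x.

(* h |-> killing h _ , from H to its dual: invertible when L is semisimple and
   H is a Cartan subalgebra, which gives its use in dual_form the intended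
   meaning. *)
Definition killing_dual : 'Hom(subvs_of H, dual) :=
  linfun (fun h : subvs_of H =>
    linfun (fun h' : subvs_of H => killing (vsval h) (vsval h') : K^o) : dual).

Definition dual_form (a b : dual) : K :=
  killing (vsval ((killing_dual^-1)%VF a)) (vsval ((killing_dual^-1)%VF b)).

Definition reflection (b : dual) : 'End(dual) :=
  linfun (fun a : dual => a - (2 * dual_form a b / dual_form b b) *: b).

(* Reflections are involutions, so the monoid they generate is a group. *)
Inductive weyl_group : set 'End(dual) :=
| weyl_id : weyl_group \1%VF
| weyl_refl b w :
    is_root b -> weyl_group w -> weyl_group (reflection b \o w)%VF.

(* The associated positive roots are those with nonnegative coordinates. *)
Definition simple_roots (n : nat) (alpha : n.-tuple dual) : Prop :=
  [/\ basis_of fullv alpha,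
      forall i, is_root (tnth alpha i)
    & forall b, is_root b -> exists k : 'I_n -> nat,
        b = \sum_i tnth alpha i *+ k i \/
        b = - (\sum_i tnth alpha i *+ k i)].

End Roots.
End LieAlgebra.

(* The i-th simple root is identified with the i-th standard basis vector.
   Roots, and images of simple roots under the Weyl group, have integer
   coordinates in the basis of simple roots, so taking real parts of the
   coordinates loses nothing below. *)

Section Realization.
Variables (R : realType) (L : vectType R[i]) (ad : 'Hom(L, 'End(L))).
Variables (H : {vspace L}) (n : nat) (alpha : n.-tuple (dual H)).

Definition root_vec (b : dual H) : 'cV[R]_n :=
  \col_i complex.Re (coord alpha i b).

Definition act_mx (w : 'End(dual H)) : 'M[R]_n :=
  \matrix_(i, j) complex.Re (coord alpha i (w (tnth alpha j))).

Definition Delta : set 'cV[R]_n := root_vec @` [set b | is_root ad b].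

Definition Delta_pos : set 'cV[R]_n :=
  [set v | Delta v /\ forall i, 0 <= v i 0].

(* The set of positive roots is finite, so this is the sum over all of it. *)
Definition delta : 'cV[R]_n := 2^-1 *: \sum_(v \in Delta_pos) v.

Definition MW : set 'M[R]_n := act_mx @` weyl_group ad (H := H).

Definition simple_refl (i : 'I_n) : 'M[R]_n :=
  act_mx (reflection ad (tnth alpha i)).

Definition primary (w : 'M[R]_n) : 'cV[R]_n := delta - w *m delta.

Definition primary_le (a b : 'M[R]_n) : Prop :=
  forall i, primary a i 0 <= primary b i 0.

Definition word_mx (s : seq 'I_n) : 'M[R]_n :=
  foldr (fun i w => simple_refl i *m w) 1%:M s.

Definition has_length (w : 'M[R]_n) (k : nat) : Prop :=
  (exists2 s, size s = k & word_mx s = w) /\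
  (forall s, word_mx s = w -> (k <= size s)%N).

Definition cox_refl (t : 'M[R]_n) : Prop :=
  exists2 u, MW u & exists i, t = u *m simple_refl i *m invmx u.

Definition bruhat_step (a b : 'M[R]_n) : Prop :=
  [/\ MW a,
      exists2 t, cox_refl t & b = a *m t
    & exists k l, [/\ has_length a k, has_length b l & (k < l)%N]].

(* The reflexive version; in particular it contains the strict order. *)
Definition bruhat : 'M[R]_n -> 'M[R]_n -> Prop :=
  clos_refl_trans 'M[R]_n bruhat_step.

End Realization.

(* Main.v *)
Require Import Defs.
From HB Require Import structures.
From mathcomp Require Import all_boot all_order all_algebra.
From mathcomp Require Import mathcomp_extra boolp classical_sets fsbigop reals.
From mathcomp Require Import complex.
From mathcomp Require Import ring zify.

Set Implicit Arguments.
Unset Strict Implicit.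
Unset Printing Implicit Defensive.

Import Order.TTheory GRing.Theory Num.Theory.

Local Open Scope ring_scope.
Local Open Scope classical_set_scope.
Local Open Scope complex_scope.

(** By transitivity it is enough to compare [a] with [b = a t] when [t] is a
    reflection and [b] is longer than [a].  Write [t = s_g] for a root [g], which
    may be taken positive, since [s_g = s_(-g)].  Then
    [a delta - b delta = a (delta - s_g delta) = 2 (g, delta) / (g, g) * a g],
    and the inequality follows from two facts.
    - [(g, delta)] is nonnegative ([half_sum_gram_ge0]).  It suffices to treat a
      simple root [alpha_i]: [s_i] permutes the positive roots that are not
      multiples of [alpha_i], so these contribute nothing to
      [(alpha_i, delta)], and the remaining ones contribute a nonnegative amount.
    - [a g] is positive.  Otherwise, by the strong exchange property
      ([exchange]), deleting a letter from a shortest word for [a] gives a word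
      for [a t = b], and [b] would be shorter than [a].

    What these arguments need from the Lie algebra is that the roots form a
    finite set stable under their reflections, and that the form dual to the
    Killing form is real on roots with [(g, g) > 0].  This is derived as follows.
    Simultaneous diagonalization of the Cartan subalgebra [H] decomposes [L] into
    weight spaces ([simultaneous_eigenbasis]), and by maximality of [H] the
    weight space of [0] is [H].  For [x] of weight [a], [y] of weight [- a] and
    [h = [x, y]], the computation with strings of weights known from sl2
    ([root_string]) gives [2 b(h) = (q - 2 p) a(h)] for each weight [b], with
    natural numbers [p] and [q], and enough nonzero weight vectors along the
    string to see that the reflection of [b] is again a weight
    ([reflected_weight]).  In particular [a(h) = 0] forces [h] to be central, so
    [h = 0], and the Killing form satisfies [K(h, h) = s a(h)^2] with [s > 0]
    ([killing_coroot]).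

    The remaining point is that each root [a] has such a pair with [h <> 0].
    Cartan's criterion is avoided: the weight vectors of nonzero weight lying in
    the radical of the Killing form span an ideal, whose elements bracket to zero
    with weight vectors of opposite weight.  By Engel's theorem
    ([nil_ideal0]) that ideal would have a nonzero centre, which is an abelian
    ideal of [L]; so it is zero.  Hence a root vector [x] of weight [a] has a
    partner [y] with [K(x, y) <> 0], and [h / K(x, y)] represents [a] with
    respect to the Killing form ([root_coroot]). *)

Import passmx.

(** * Linear maps and traces *)

Section Trace.
Variables (K : fieldType) (L : vectType K).
Implicit Types f g : 'End(L).

Lemma lfun_trace_linear : linear (@lfun_trace K L : 'End(L) -> K^o).
Proof. by move=> c f g; rewrite /lfun_trace !linearP. Qed.
HB.instance Definition _ := GRing.isLinear.Build K 'End(L) K^o _ _ lfun_trace_linear.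

Lemma lfun_traceC f g : lfun_trace (f \o g)%VF = lfun_trace (g \o f)%VF.
Proof. by rewrite /lfun_trace !(mxof_comp _ _ (vbasisP _)) mxtrace_mulC. Qed.

Lemma lfun_trace_basis (r : (\dim {:L}).-tuple L) f : basis_of {:L} r ->
  lfun_trace f = \sum_i coord r i (f (tnth r i)).
Proof.
move=> rB; pose e := vbasis {:L}; have eB : basis_of {:L} e by exact: vbasisP.
have -> : lfun_trace f = \tr (mxof r r f).
  have fE : f = (\1 \o (f \o \1))%VF by rewrite comp_lfun1l comp_lfun1r.
  rewrite [in RHS]fE (mxof_comp r r eB) (mxof_comp r e eB).
  rewrite -mulmxA mxtrace_mulC -mulmxA -(mxof_comp e e rB).
  by rewrite comp_lfun1l mxof1 ?(basis_free eB) // mulmx1.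
by apply: eq_bigr => i _; rewrite !mxE /= vecof_delta -tnth_nth.
Qed.

End Trace.

(** Lets a linear map given by a raw function be evaluated without declaring a
    structure for that function. *)
Lemma linfun_linearE (K : fieldType) (U V : vectType K) (f : U -> V) :
  linear f -> linfun f =1 f.
Proof.
move=> fL; pose fl := GRing.isLinear.Build _ _ _ _ f fL.
by pose F : {linear U -> V} := HB.pack f fl; exact: (lfunE F).
Qed.

(** * The bracket and the Killing form *)

Section LieBracket.
Variables (K : numFieldType) (L : vectType K) (ad : 'Hom(L, 'End(L))).
Hypothesis lieL : is_lie_bracket ad.

Lemma bracketZl c x y : ad (c *: x) y = c *: ad x y.
Proof. by rewrite linearZ scale_lfunE. Qed.

Lemma bracketDl x y z : ad (x + y) z = ad x z + ad y z.
Proof. by rewrite linearD add_lfunE. Qed.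

Lemma bracket_suml I (r : seq I) (F : I -> L) z :
  ad (\sum_(i <- r) F i) z = \sum_(i <- r) ad (F i) z.
Proof. by rewrite linear_sum sum_lfunE. Qed.

Lemma bracketC x y : ad x y = - ad y x.
Proof.
have [alt _] := lieL; apply/eqP; rewrite -addr_eq0; apply/eqP.
have := alt (x + y); rewrite bracketDl /= !linearD /= !alt.
by rewrite add0r addr0 addrC.
Qed.

Lemma bracket_jacobi x y z : ad x (ad y z) = ad (ad x y) z + ad y (ad x z).
Proof.
have [_ jac] := lieL; have := jac x y z.
rewrite (bracketC z (ad x y)) (bracketC z x) linearN /= -addrA => /eqP.
by rewrite -opprD addr_eq0 opprK addrC => /eqP.
Qed.

Lemma ad_bracket x y : ad (ad x y) = (ad x \o ad y)%VF - (ad y \o ad x)%VF.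
Proof.
apply/lfunP => z; rewrite add_lfunE opp_lfunE !comp_lfunE.
by rewrite (bracket_jacobi x y z) addrK.
Qed.

Lemma killingC x y : killing ad x y = killing ad y x.
Proof. exact: lfun_traceC. Qed.

Lemma killing_linear x : linear (killing ad x : L -> K^o).
Proof.
move=> c y z.
by rewrite /killing linearP comp_lfunDr -comp_lfunZr linearP.
Qed.
HB.instance Definition _ x := GRing.isLinear.Build K L K^o _ _ (killing_linear x).

(** Cyclicity of the trace, once [ad] is known to send brackets to commutators. *)
Lemma killing_invariant x y z : killing ad (ad x y) z = killing ad x (ad y z).
Proof.
rewrite /killing !ad_bracket comp_lfunDl comp_lfunNl comp_lfunDr comp_lfunNr.
rewrite !linearB /= !comp_lfunA; congr (_ - _).
by rewrite -(comp_lfunA (ad y)) lfun_traceC.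
Qed.

(** * Engel's theorem and nilpotent ideals *)

Lemma bracket_span (ts : seq L) (U : {vspace L}) v w :
  (forall t, t \in ts -> ad t v \in U) -> w \in <<ts>>%VS -> ad w v \in U.
Proof.
move=> tsU wts; rewrite (coord_span (X := in_tuple ts) wts) bracket_suml.
apply: memv_suml => i _; rewrite bracketZl; apply: memvZ; apply: tsU.
exact: mem_nth.
Qed.

(** A form of: the elements of [ts] act nilpotently as a family.  Each stable
    subspace [U] can be enlarged by a vector that [ts] sends into [U], and this
    vector can be taken in any prescribed stable set [Q].  Letting [Q]
    range over sets, such as unions of weight spaces, keeps the vectors found
    homogeneous. *)
Definition has_flags (ts : seq L) : Prop :=
  forall (Q : L -> Prop) (U : {vspace L}),
    (forall t v, t \in ts -> Q v -> Q (ad t v)) ->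
    (forall t v, t \in ts -> v \in U -> ad t v \in U) ->
    (exists2 v, Q v & v \notin U) ->
  exists v, [/\ Q v, v \notin U & forall t, t \in ts -> ad t v \in U].

(** The inductive step of Engel's theorem.  The vectors of [Q] that [ts] sends
    into [U] are stable under [u], because [u] normalizes the span of [ts]; the
    last of the iterates [v, [u, v], ...] outside [U] is sent into [U] by [u]
    also. *)
Lemma has_flags_cons (ts : seq L) u :
    has_flags ts -> (forall t, t \in ts -> ad t u \in <<ts>>%VS) ->
    (exists N, forall v, iter N (ad u) v = 0) ->
  has_flags (u :: ts).
Proof.
move=> flag_ts norm_u [N uN] Q U Qst Ust QU.
have [|t v tts|v [Qv vU tsv]] := flag_ts Q U _ _ QU.
- by move=> t v tts; apply: Qst; rewrite inE tts orbT.
- by apply: Ust; rewrite inE tts orbT.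
have [//|uts] := boolP (u \in ts).
  by exists v; split=> // t; rewrite inE => /orP[/eqP ->|/tsv//]; apply: tsv.
have uQ k : Q (iter k (ad u) v).
  by elim: k => //= k IH; apply: Qst => //; rewrite mem_head.
have uU k t : t \in ts -> ad t (iter k (ad u) v) \in U.
  elim: k t => /= [|k IH] t tts; first exact: tsv.
  rewrite bracket_jacobi memvD //; last by apply: Ust; rewrite ?mem_head ?IH.
  by apply: (bracket_span (ts := ts)); [apply: IH | apply: norm_u].
have ex : exists k, iter k (ad u) v \in U by exists N; rewrite uN mem0v.
case: (ex_minnP ex) => [[|k]] kU kmin; first by rewrite /= (negPf vU) in kU.
exists (iter k (ad u) v); split=> // [|t].
  by apply/negP => /kmin; rewrite ltnn.
by rewrite inE => /orP[/eqP -> //|/uU].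
Qed.

(** Engel's theorem for a set that is closed under brackets but need not be a
    subspace, after Jacobson.  A family with span a proper part of that of [S]
    is enlarged by applying [has_flags] to [S] itself and to the span: this gives
    an element of [S] outside the span that normalizes it. *)
Lemma engel (S : L -> Prop) :
    (forall x y, S x -> S y -> S (ad x y)) ->
    (forall x, S x -> exists N, forall v, iter N (ad x) v = 0) ->
  exists ts : seq L, [/\ forall t, t \in ts -> S t,
    forall x, S x -> x \in <<ts>>%VS & has_flags ts].
Proof.
move=> Sbr Snil.
have grow k ts : (\dim {:L} - size ts <= k)%N -> free ts ->
    (forall t, t \in ts -> S t) ->
    (forall t u, t \in ts -> u \in ts -> ad t u \in <<ts>>%VS) ->
    has_flags ts ->
  exists ts : seq L, [/\ forall t, t \in ts -> S t,
    forall x, S x -> x \in <<ts>>%VS & has_flags ts].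
  elim: k ts => [|k IH] ts tsk frts tsS tscl flts;
    (have [Sts|/existsNP[x /not_implyP[Sx xts]]] :=
      pselect (forall x, S x -> x \in <<ts>>%VS); first by exists ts).
    have full : (<<ts>> == {:L})%VS.
      rewrite eqEdim subvf (eqP frts).
      by rewrite -subn_eq0 -leqn0.
    by case: xts; rewrite (eqP full) memvf.
  have tsst t v : t \in ts -> v \in <<ts>>%VS -> ad t v \in <<ts>>%VS.
    move=> tts vts; rewrite bracketC memvN.
    apply: (bracket_span _ vts) => w wts; exact: tscl.
  (* [u] lies in [S], outside the span of [ts], and normalizes this span. *)
  have [t v /tsS tS vS||u [Su uts ucl]] := flts S <<ts>>%VS _ tsst.
  - exact: Sbr.
  - by exists x => //; apply/negP.
  apply: (IH (u :: ts)) => [||t|t w|].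
  - by rewrite /=; lia.
  - by rewrite free_cons uts.
  - by rewrite inE => /orP[/eqP -> //|/tsS].
  - have sub y : y \in <<ts>>%VS -> y \in <<u :: ts>>%VS.
      by rewrite span_cons; apply/subvP; apply: addvSr.
    rewrite !inE => /orP[/eqP ->|tts] /orP[/eqP ->|wts]; apply: sub.
    + by have [alt _] := lieL; rewrite alt mem0v.
    + by rewrite bracketC memvN ucl.
    + exact: ucl.
    + exact: tscl.
  - by apply: has_flags_cons => //; apply: Snil.
apply: (grow _ [::]) => //; first exact: nil_free.
by move=> Q U _ _ [v Qv vU]; exists v.
Qed.

Lemma abelian_ideal0 (I : {vspace L}) : lie_semisimple ad ->
  lie_ideal ad I -> lie_abelian ad I -> I = 0%VS.
Proof.
move=> ssL idI abI; apply: ssL => //; exists 1%N => /=.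
apply/eqP; rewrite -subv0; apply/span_subvP => z.
move=> /allpairsP[[x y] /= [/vbasis_mem xI /vbasis_mem yI ->]].
by rewrite abI // mem0v.
Qed.

Lemma center0 x : lie_semisimple ad -> (forall y, ad x y = 0) -> x = 0.
Proof.
move=> ssL x0; apply/eqP; rewrite -memv0 -(abelian_ideal0 (I := <[x]>) ssL).
- exact: memv_line.
- by move=> y _ /vlineP[c ->]; rewrite linearZ /= bracketC x0 oppr0 scaler0 mem0v.
- by move=> _ y /vlineP[c ->] _; rewrite bracketZl x0 scaler0.
Qed.

(** By Engel's theorem the span of a nonzero [S] has a nonzero centre; as the span
    is an ideal of [L], so is its centre, which is abelian.  The spanning
    family [B] makes it possible to check on weight vectors alone that the span
    is an ideal. *)
Lemma nil_ideal0 (S : L -> Prop) : lie_semisimple ad ->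
    (forall x y, S x -> S y -> S (ad x y)) ->
    (forall x, S x -> exists N, forall v, iter N (ad x) v = 0) ->
    (exists2 B : seq L, <<B>>%VS = fullv &
       forall x b, S x -> b \in B -> S (ad x b)) ->
  forall x, S x -> x = 0.
Proof.
move=> ssL Sbr Snil [B Bfull SB] x Sx; apply/eqP; apply: contraT => x0.
have [ts [tsS Sts flts]] := engel Sbr Snil.
(* Flags above the zero subspace give an element of [S] killed by the family. *)
have [t v /tsS tS vS|t v tts||z [Sz z0 tsz]] := flts S 0%VS.
- exact: Sbr.
- by rewrite !memv0 => /eqP ->; rewrite linear0.
- by exists x; rewrite ?memv0.
(* [Z] is the centre of the span of [S]; it contains [z]. *)
pose Z := (<<ts>> :&: \bigcap_(t <- ts) lker (ad t))%VS.
have ZP v : reflect (v \in <<ts>>%VS /\ forall t, t \in ts -> ad t v = 0) (v \in Z).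
  rewrite memv_cap; apply: (iffP andP) => -[vts vk]; split=> //.
    move=> t tts; apply/eqP; rewrite -memv_ker.
    by move: vk; rewrite (big_rem t) //= memv_cap => /andP[].
  rewrite big_seq; elim/big_ind: _ => [|U V vU vV|t tts]; first exact: memvf.
    by rewrite memv_cap vU.
  by rewrite memv_ker vk.
have ZK v w : v \in Z -> w \in <<ts>>%VS -> ad w v = 0.
  move=> /ZP[_ vt] wts; apply/eqP; rewrite -memv0.
  by apply: (bracket_span _ wts) => t tts; rewrite vt ?mem0v.
have Z0 : Z = 0%VS.
  apply: abelian_ideal0 => //; last by move=> u v /ZP[uts _] vZ; apply: ZK.
  move=> y v vZ; have yB : y \in <<B>>%VS by rewrite Bfull memvf.
  apply: (bracket_span _ yB) => b bB; apply/ZP; split.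
    rewrite bracketC memvN; have /ZP[vts _] := vZ.
    by apply: (bracket_span _ vts) => t tts; apply: Sts; apply: SB => //; apply: tsS.
  move=> t tts; rewrite bracket_jacobi (ZK v (ad t b)) //; last first.
    by apply: Sts; apply: SB => //; apply: tsS.
  by have /ZP[_ vt] := vZ; rewrite vt // linear0 addr0.
move: z0; rewrite -Z0 => /ZP[]; split; first exact: Sts.
by move=> t /tsz; rewrite memv0 => /eqP.
Qed.

(** * Weights of a Cartan subalgebra *)

Section Cartan.
Variable H : {vspace L}.
Local Notation dual := (dual H).

Definition weight_vector (a : dual) (x : L) : Prop :=
  forall h : subvs_of H, ad (vsval h) x = a h *: x.

Lemma weight_vector0 a : weight_vector a 0.
Proof. by move=> h; rewrite linear0 scaler0. Qed.

Lemma weight_vectorZ a c x : weight_vector a x -> weight_vector a (c *: x).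
Proof. by move=> ax h; rewrite linearZ /= ax !scalerA mulrC. Qed.

Lemma weight_vector_bracket a b x y :
  weight_vector a x -> weight_vector b y -> weight_vector (a + b) (ad x y).
Proof.
move=> ax by_ h; rewrite bracket_jacobi ax by_ bracketZl linearZ /=.
by rewrite add_lfunE scalerDl.
Qed.

Lemma weight_vector_iter a b x v k :
  weight_vector a x -> weight_vector b v ->
  weight_vector (b + a *+ k) (iter k (ad x) v).
Proof.
move=> ax bv; elim: k => [|k IH]; first by rewrite mulr0n addr0.
by rewrite iterS mulrSr addrA addrC; apply: weight_vector_bracket.
Qed.

Hypothesis cartanH : cartan_subalgebra ad H.

(** Adding to [H] an element that commutes with it gives an abelian subalgebra, so
    this is the maximality of [H]. *)
Lemma weight_zero_cartan x : weight_vector 0 x -> x \in H.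
Proof.
have [abH maxH _] := cartanH => x0.
have Hx h : h \in H -> ad h x = 0.
  by move=> hH; have := x0 (vsproj H h); rewrite vsprojK // zero_lfunE scale0r.
rewrite -(maxH (H + <[x]>)%VS).
- by rewrite memvE addvSr.
- move=> u w /memv_addP[h hH [_ /vlineP[c ->] ->{u}]].
  move=> /memv_addP[h' hH' [_ /vlineP[c' ->] ->{w}]].
  have [alt _] := lieL.
  rewrite bracketDl bracketZl !linearD !linearZ /= alt abH // Hx //.
  by rewrite (bracketC x) Hx // oppr0 !(scaler0, addr0).
- exact: addvSl.
Qed.

(** Commuting diagonalizable matrices are simultaneously diagonalizable; a basis of
    [H] gives finitely many of them.  The rows of the change of basis are the
    eigenvectors, and their eigenvalues are linear in the element of [H]. *)
Lemma simultaneous_eigenbasis :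
  exists (r : (\dim {:L}).-tuple L) (lam : 'I_(\dim {:L}) -> dual),
    basis_of {:L} r /\ forall i, weight_vector (lam i) (tnth r i).
Proof.
have [abH _ diagH] := cartanH.
pose e := vbasis {:L}.
have eB : basis_of {:L} e by exact: vbasisP.
pose M h := mxof e e (ad h).
have [] := (codiagonalizableP [seq M h | h <- vbasis H]).1.
  split=> [_ _ /mapP[h hH ->] /mapP[h' hH' ->]|_ /mapP[h hH ->]].
    rewrite /comm_mx -!mxof_comp //; congr mxof.
    apply/lfunP => x; rewrite !comp_lfunE bracket_jacobi.
    by rewrite (abH h' h) ?(vbasis_mem hH) ?(vbasis_mem hH') // linear0 zero_lfunE add0r.
  have [b bB bE] := diagH h (vbasis_mem hH).
  have sb : size b = \dim {:L} by rewrite -(span_basis bB) (eqP (basis_free bB)).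
  pose b' := tcast sb (in_tuple b).
  have b'E : b' = b :> seq L by rewrite val_tcast.
  have b'B : basis_of {:L} b' by rewrite b'E.
  pose P := mxof b' e \1%VF.
  pose Q := mxof e b' \1%VF.
  have PQ : P *m Q = 1%:M.
    by rewrite -mxof_comp // comp_lfun1l mxof1 // (basis_free b'B).
  have [Pu _] := mulmx1_unit PQ.
  exists P => //; apply/(similar_diagPex).
  have cE i : exists c : K, ad h (tnth b' i) = c *: tnth b' i.
    by apply: bE; rewrite -b'E mem_tnth.
  have [c cP] := choice cE.
  exists (\row_i c i); apply/(similarP Pu).
  apply/row_matrixP => i; rewrite !row_mul row_diag_mx -scalemxAl -rowE mxE.
  have rP : row i P = rVof e (tnth b' i).
    by rewrite rowE mul_mxof vecof_delta -tnth_nth id_lfunE.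
  rewrite rP /M -rVof_app // cP. by rewrite linearZ.
move=> P Pu /allP PD.
pose r : (\dim {:L}).-tuple L := [tuple vecof e (row i P) | i < \dim {:L}].
have rE h i : h \in H -> exists c : K, ad h (tnth r i) = c *: tnth r i.
  move=> hH; rewrite tnth_mktuple (coord_vbasis hH).
  have ck (k : 'I_(\dim H)) : exists c : K, ad (vbasis H)`_k
       (vecof e (row i P)) = c *: vecof e (row i P).
    have /PD /= /similar_diagPex[D /(similarP Pu) PM] :
      M (vbasis H)`_k \in [seq M h | h <- vbasis H].
      by apply: map_f; rewrite mem_nth // size_tuple.
    exists (D 0 i); rewrite (hom_vecof e eB) -/(M _) -row_mul PM row_mul.
    by rewrite row_diag_mx -scalemxAl -rowE linearZ.
  have [c cP] := choice ck.
  exists (\sum_k coord (vbasis H) k h * c k).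
  rewrite bracket_suml scaler_suml; apply: eq_bigr => k _.
  by rewrite bracketZl cP scalerA.
have rB : basis_of {:L} r.
  rewrite basisEdim size_tuple leqnn andbT; apply/subvP => v _.
  rewrite -[v](rVofK eB) -[rVof e v](mulmxKV Pu).
  rewrite mulmx_sum_row linear_sum /=; apply: memv_suml => i _.
  rewrite linearZ /=; apply: memvZ; apply: memv_span.
  by have := mem_tnth i r; rewrite tnth_mktuple.
exists r.
pose lamf i := fun h : subvs_of H => coord r i (ad (vsval h) (tnth r i)) : K^o.
have lam_lin i : linear (lamf i).
  move=> c u v; rewrite /lamf.
  have -> : vsval (c *: u + v) = c *: vsval u + vsval v by rewrite linearP.
  by rewrite bracketDl bracketZl linearP.
pose laml i := GRing.isLinear.Build _ _ _ _ (lamf i) (lam_lin i).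
pose lamL i : {linear subvs_of H -> K^o} := HB.pack (lamf i) (laml i).
exists (fun i => linfun (lamL i)); split=> // i h.
rewrite lfunE /= /lamf; have [c ->] := rE _ i (subvsP h).
rewrite linearZ /= {2}(tnth_nth 0) coord_free ?(basis_free rB) // eqxx.
by rewrite mulr1.
Qed.

(** * The form on the dual of the Cartan subalgebra *)

Lemma dual_formC (a b : dual) : dual_form ad a b = dual_form ad b a.
Proof. exact: killingC. Qed.

Lemma dual_formDr (a b b' : dual) :
  dual_form ad a (b + b') = dual_form ad a b + dual_form ad a b'.
Proof. by rewrite /dual_form !linearD. Qed.

Lemma dual_formZr (a : dual) c (b : dual) :
  dual_form ad a (c *: b) = c * dual_form ad a b.
Proof. by rewrite /dual_form !linearZ. Qed.

Lemma reflectionE (b a : dual) :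
  reflection ad b a = a - (2 * dual_form ad a b / dual_form ad b b) *: b.
Proof.
rewrite /reflection linfun_linearE // => c u v.
have -> : dual_form ad (c *: u + v) b = c * dual_form ad u b + dual_form ad v b.
  by rewrite dual_formC dual_formDr dual_formZr -![dual_form ad b _]dual_formC.
rewrite mulrDr mulrDl scalerDl scalerBr opprD addrACA; congr (_ - _ + _).
by rewrite scalerA; congr (_ *: _); rewrite !mulrA [c * 2]mulrC.
Qed.

Lemma killing_dualE (h h' : subvs_of H) :
  killing_dual ad H h h' = killing ad (vsval h) (vsval h').
Proof.
have lin k : linear (fun k' : subvs_of H => killing ad (vsval k) (vsval k') : K^o).
  by move=> c u v; rewrite !linearP.
rewrite /killing_dual linfun_linearE ?linfun_linearE // => c u v.
apply/lfunP => k; rewrite add_lfunE scale_lfunE !linfun_linearE //.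
by rewrite killingC !linearP /= ![killing ad (vsval k) _]killingC.
Qed.

(** * Strings of weights *)

Lemma dual_mulrnI (a : dual) : a != 0 -> injective (GRing.natmul a).
Proof.
move=> a0 j k; rewrite -!scaler_nat => /eqP.
rewrite -subr_eq0 -scalerBl scaler_eq0 (negPf a0) orbF subr_eq0 eqr_nat.
by move=> /eqP.
Qed.

(** The arithmetic of the inductive step in the sl2 computation: [j] counts the
    applications of the lowering element, [m] is the eigenvalue at the top of the
    string and [c] the one on the raising element; all is doubled to avoid the
    halves in [k m - k (k - 1) c / 2]. *)
Lemma string_identity (F : numFieldType) (m c j : F) :
  (m - (j + 1) * c) *+ 2 + (j + 1) * (m *+ 2 - j * c) =
  (j + 1 + 1) * (m *+ 2 - (j + 1) * c).
Proof. by ring. Qed.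

Section Spectrum.
Variables (r : (\dim {:L}).-tuple L) (lam : 'I_(\dim {:L}) -> dual).
Hypothesis rB : basis_of {:L} r.
Hypothesis rlam : forall i, weight_vector (lam i) (tnth r i).

Lemma weight_in_spectrum a x :
  x != 0 -> weight_vector a x -> exists i, lam i = a.
Proof.
move=> x0 ax; have xE := coord_basis rB (memvf x).
have [i ci] : exists i, coord r i x != 0.
  apply/existsP; apply: contraR x0; rewrite negb_exists => /forallP c0.
  by rewrite xE big1 // => i _; move: (c0 i); rewrite negbK => /eqP ->; rewrite scale0r.
exists i; apply/lfunP => h; apply: (mulIf ci).
have <- : coord r i (ad (vsval h) x) = a h * coord r i x by rewrite ax linearZ.
rewrite {2}xE !linear_sum /= (bigD1 i) //= big1 ?addr0 => [|j ji].
  by rewrite linearZ /= -tnth_nth rlam !linearZ /= (tnth_nth 0) coord_free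
    ?(basis_free rB) // eqxx mulr1 mulrC.
rewrite linearZ /= -tnth_nth rlam !linearZ /= (tnth_nth 0) coord_free
  ?(basis_free rB) //.
by rewrite (negPf ji) !mulr0.
Qed.

(** Bracketing with [x] adds [a] to the weight, and only finitely many weights
    occur. *)
Lemma bracket_nilpotent a x : a != 0 -> weight_vector a x ->
  exists N, forall v, iter N (ad x) v = 0.
Proof.
move=> a0 ax; exists (\dim {:L}).
have wt0 b v : weight_vector b v -> iter (\dim {:L}) (ad x) v = 0.
  move=> bv; apply/eqP; apply: contraT => v0.
  have nz (k : 'I_(\dim {:L}).+1) : exists i, lam i = b + a *+ k.
    apply: (weight_in_spectrum (x := iter k (ad x) v)).
      apply: contraNN v0 => /eqP k0; rewrite -(subnK (leq_ord k)) iterD k0.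
      by elim: (_ - _)%N => //= m /eqP ->; rewrite linear0.
    exact: weight_vector_iter.
  have [f fE] := choice nz.
  have : injective f.
    move=> j k fjk; apply: val_inj; apply: (dual_mulrnI a0); apply: (addrI b).
    by rewrite -!fE fjk.
  by move=> /leq_card; rewrite !card_ord ltnn.
move=> v; rewrite [v](coord_basis rB) ?memvf //.
have itD N : {morph iter N (ad x) : u w / u + w}.
  by move=> u w; elim: N => //= m ->; rewrite linearD.
have it0 N : iter N (ad x) 0 = 0 by elim: N => //= m ->; rewrite linear0.
rewrite (big_morph _ (itD _) (it0 _)) big1 // => i _.
by apply: (wt0 (lam i)); rewrite -tnth_nth; apply: weight_vectorZ.
Qed.

(** Raise [v] by [x] to the top [w] of its string, in [p] steps, then lower [w] by
    [y] until it vanishes, after [q] steps.  Comparing [x y^(q+1) w = 0] with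
    the value obtained by commuting [x] to the right determines the eigenvalue
    of [h] on [w].  When [a h = 0] the conclusion is that
    all weights vanish at [h]. *)
Lemma root_string a b x y (h : subvs_of H) v :
    a != 0 -> weight_vector a x -> weight_vector (- a) y ->
    ad x y = vsval h -> v != 0 -> weight_vector b v ->
  exists p q : nat,
    b h *+ 2 = q%:R * a h - p%:R * a h *+ 2 /\
    forall k, (k <= q)%N ->
      exists2 u, u != 0 & weight_vector (b + a *+ p - a *+ k) u.
Proof.
move=> a0 ax ay xyE v0 bv.
have last_nonzero c z u : c != 0 -> weight_vector c z -> u != 0 ->
    exists k, iter k (ad z) u != 0 /\ iter k.+1 (ad z) u = 0.
  move=> c0 cz u0; have [N N0] := bracket_nilpotent c0 cz.
  have ex : exists k, iter k (ad z) u == 0 by exists N; rewrite N0.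
  case: (ex_minnP ex) => [[|k]]; first by rewrite /= (negPf u0).
  by move=> /eqP k0 kmin; exists k; split=> //; apply/negP => /kmin; rewrite ltnn.
have [p [p0 p1]] := last_nonzero _ _ _ a0 ax v0.
set w := iter p (ad x) v in p0 p1.
have Na0 : - a != 0 by rewrite oppr_eq0.
have [q [q0 q1]] := last_nonzero _ _ _ Na0 ay p0.
have cw : weight_vector (b + a *+ p) w by apply: weight_vector_iter.
have wk k : weight_vector (b + a *+ p - a *+ k) (iter k (ad y) w).
  by rewrite -mulNrn; apply: weight_vector_iter.
exists p, q; split; last first.
  move=> k kq; exists (iter k (ad y) w) => //; apply: contraNneq q0 => k0.
  rewrite -(subnK kq) iterD k0; elim: (_ - _)%N => //= m /eqP ->.
  by rewrite linear0.
pose m := b h + p%:R * a h.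
have hwk k : ad (vsval h) (iter k (ad y) w) = (m - k%:R * a h) *: iter k (ad y) w.
  rewrite wk; congr (_ *: _).
  by rewrite add_lfunE opp_lfunE add_lfunE -!scaler_nat !scale_lfunE.
have xyk k : ad x (iter k.+1 (ad y) w) *+ 2 =
    (k.+1%:R * (m *+ 2 - k%:R * a h)) *: iter k (ad y) w.
  elim: k => [|k IH].
    have xw : ad x w = 0 by [].
    rewrite /= bracket_jacobi xw linear0 addr0 xyE (hwk 0) mul0r !subr0 mul1r.
    by rewrite scalerMnl.
  rewrite iterS bracket_jacobi xyE hwk mulrnDl.
  have -> : ad y (ad x (iter k.+1 (ad y) w)) *+ 2 =
      (k.+1%:R * (m *+ 2 - k%:R * a h)) *: iter k.+1 (ad y) w.
    by rewrite -linearMn IH linearZ.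
  rewrite scalerMnl -scalerDl; congr (_ *: _).
  rewrite -(natr1 k.+1) -(natr1 k); exact: string_identity.
have := xyk q; rewrite q1 linear0 mul0rn => /esym/eqP.
rewrite scaler_eq0 (negPf q0) orbF mulf_eq0 pnatr_eq0 /= subr_eq0 => /eqP.
rewrite /m mulrnDl => <-.
by rewrite addrK.
Qed.

(** The target [b - c a] lies on the lowering part of the string when [c >= 0].
    When [c < 0], exchanging [x] and [y] replaces [a] and [h] by their opposites,
    and [c] by [- c], without changing the target. *)
Lemma reflected_weight a b x y (h : subvs_of H) v :
    a != 0 -> weight_vector a x -> weight_vector (- a) y -> ad x y = vsval h ->
    v != 0 -> weight_vector b v ->
  exists c : int, b h *+ 2 = c%:~R * a h /\
    exists2 u, u != 0 & weight_vector (b - c%:~R *: a) u.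
Proof.
move=> a0 ax ay xyE v0 bv.
have up (a' : dual) x' y' h' : a' != 0 -> weight_vector a' x' ->
    weight_vector (- a') y' -> ad x' y' = vsval h' ->
  exists p q : nat, b h' *+ 2 = (q%:Z - p%:Z *+ 2)%:~R * a' h' /\
    ((p.*2 <= q)%N -> exists2 u, u != 0 &
       weight_vector (b - (q%:Z - p%:Z *+ 2)%:~R *: a') u).
  move=> a'0 ax' ay' xyE'.
  have [p [q [pqE str]]] := root_string a'0 ax' ay' xyE' v0 bv.
  exists p, q; split=> [|pq].
    by rewrite pqE rmorphB rmorphMn /= mulrBl -!pmulrn -mulrnAl.
  (* The target lies [q - p] steps below the top of the string. *)
  have [|u u0 pu] := str (q - p)%N; first by rewrite leq_subr.
  exists u => //; congr weight_vector: pu.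
  have pq' : (p <= q)%N by lia.
  rewrite rmorphB rmorphMn /= -!pmulrn -addrA; congr (_ + _).
  rewrite -[in RHS](subnK pq') natrD mulr2n opprD addrA addrK.
  by rewrite scalerBl opprB !scaler_nat.
have Na0 : - a != 0 by rewrite oppr_eq0.
have ay' : weight_vector (- - a) x by rewrite opprK.
have yxE : ad y x = vsval (- h) by rewrite bracketC xyE linearN.
have [p [q [pqE str]]] := up _ _ _ _ a0 ax ay xyE.
have [p' [q' [pqE' str']]] := up _ _ _ _ Na0 ay ay' yxE.
have [ah0|ah0] := eqVneq (a h) 0.
  by exists 0; rewrite pqE ah0 !mulr0; split=> //; exists v; rewrite // scale0r subr0.
have [/str|qp] := leqP p.*2 q; first by exists (q%:Z - p%:Z *+ 2).
have cE : q%:Z - p%:Z *+ 2 = - (q'%:Z - p'%:Z *+ 2).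
  apply/eqP; rewrite -(eqr_int K); apply/eqP; apply: (mulIf ah0).
  rewrite -pqE rmorphN mulNr; move: pqE'.
  by rewrite !linearN /= opp_lfunE opprK mulNrn => <-; rewrite opprK.
have [|u u0 cu] := str'; first by lia.
exists (q%:Z - p%:Z *+ 2); split=> //; exists u => //; congr weight_vector: cu.
by rewrite cE rmorphN scaleNr scalerN.
Qed.

(** * The Killing form on pairs of opposite weights *)

Lemma killing_cartan (h h' : subvs_of H) :
  killing ad (vsval h) (vsval h') = \sum_i lam i h * lam i h'.
Proof.
rewrite /killing (lfun_trace_basis _ rB); apply: eq_bigr => i _.
rewrite comp_lfunE rlam linearZ /= rlam !linearZ /= (tnth_nth 0).
by rewrite coord_free ?(basis_free rB) // eqxx mulr1 mulrC.
Qed.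

Hypothesis ssL : lie_semisimple ad.

Lemma lam_separates (h : subvs_of H) : (forall i, lam i h = 0) -> h = 0.
Proof.
move=> h0; apply: val_inj; rewrite linear0; apply: center0 => // y.
rewrite [y](coord_basis rB) ?memvf // linear_sum /= big1 // => i _.
by rewrite linearZ /= -tnth_nth rlam h0 scale0r scaler0.
Qed.

Lemma bracket_opposite a x y : weight_vector a x -> weight_vector (- a) y ->
  exists h : subvs_of H, ad x y = vsval h.
Proof.
move=> ax ay; exists (vsproj H (ad x y)); rewrite vsprojK //.
by apply: weight_zero_cartan; rewrite -(subrr a); apply: weight_vector_bracket.
Qed.

Section OppositePair.
Variables (a : dual) (x y : L) (h : subvs_of H).
Hypotheses (a0 : a != 0) (x0 : x != 0).
Hypotheses (ax : weight_vector a x) (ay : weight_vector (- a) y).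
Hypothesis xyE : ad x y = vsval h.

Lemma lam_multiple i : exists z : int, lam i h *+ 2 = z%:~R * a h.
Proof.
have ri0 : tnth r i != 0.
  by apply: (free_not0 (basis_free rB)); rewrite mem_tnth.
have [p [q [pqE _]]] := root_string a0 ax ay xyE ri0 (rlam i).
exists (q%:Z - p%:Z *+ 2); rewrite pqE.
by rewrite rmorphB rmorphMn /= mulrBl -!pmulrn -mulrnAl.
Qed.

(** All weights vanish at [h] with [a], so [h] is central. *)
Lemma coroot_eq0 : a h = 0 -> h = 0.
Proof.
move=> ah0; apply: lam_separates => i; have [z] := lam_multiple i.
by rewrite ah0 mulr0 => /eqP; rewrite mulrn_eq0 => /eqP.
Qed.

(** Each term [lam i h] of the trace is a half-integer multiple of [a h], and the
    multiple is [1] for at least one [i], as [a] occurs among the weights. *)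
Lemma killing_coroot : exists2 s : K,
  0 < s & killing ad (vsval h) (vsval h) = s * a h ^+ 2.
Proof.
have [ah0|ah0] := eqVneq (a h) 0.
  by exists 1; rewrite // coroot_eq0 // !linear0 expr2 !mulr0.
have [z zE] := choice lam_multiple.
exists (\sum_i ((z i)%:~R / 2) ^+ 2); last first.
  rewrite killing_cartan mulr_suml; apply: eq_bigr => i _.
  have -> : lam i h = (z i)%:~R / 2 * a h.
    have n2 : (2 : K) != 0 by rewrite pnatr_eq0.
    by apply: (mulIf n2); rewrite mulr_natr zE mulrAC divfK.
  by rewrite -expr2 exprMn.
have [i ia] := weight_in_spectrum x0 ax.
have sq_ge0 j : 0 <= ((z j)%:~R / 2 : K) ^+ 2.
  by apply: real_exprn_even_ge0 => //; rewrite realM // ?realV ?realn // realz.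
have zi : (z i)%:~R / 2 = 1 :> K.
  apply: (mulIf ah0); rewrite mulrAC -zE ia mul1r -[a h *+ 2]mulr_natr mulfK //.
  by rewrite pnatr_eq0.
rewrite (bigD1 i) //= zi expr1n; apply: ltr_pwDl => //.
by apply: sumr_ge0.
Qed.

Lemma killing_coroot_pairing : killing ad (vsval h) (vsval h) = a h * killing ad x y.
Proof.
rewrite -{1}xyE killing_invariant bracketC ay opp_lfunE scaleNr opprK linearZ.
by [].
Qed.

Lemma bracket0_of_killing0 : killing ad x y = 0 -> h = 0.
Proof.
move=> xy0; apply: coroot_eq0; have [s s0 sE] := killing_coroot.
move: sE; rewrite killing_coroot_pairing xy0 mulr0 => /esym/eqP.
by rewrite mulf_eq0 (gt_eqF s0) sqrf_eq0 => /eqP.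
Qed.

End OppositePair.

(** The homogeneous elements of nonzero weight in the radical of the Killing form
    are closed under brackets with weight vectors: by invariance when the weights
    are not opposite, and because the bracket vanishes when they are.  So they
    span a nilpotent ideal. *)
Lemma killing_opposite a x : a != 0 -> x != 0 -> weight_vector a x ->
  exists2 y, weight_vector (- a) y & killing ad x y != 0.
Proof.
pose S x := x = 0 \/ exists a, [/\ a != 0, weight_vector a x &
   forall y, weight_vector (- a) y -> killing ad x y = 0].
have S0 u b y : weight_vector b y -> S u -> S (ad u y).
  move=> by_ [->|[c [c0 cu kill0]]]; first by left; rewrite linear0 zero_lfunE.
  have [->|u0] := eqVneq u 0; first by left; rewrite linear0 zero_lfunE.
  have [cb|cb] := eqVneq (c + b) 0.
    left; have bE : b = - c by apply/eqP; rewrite -addr_eq0 addrC cb.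
    rewrite bE in by_; have [h hE] := bracket_opposite cu by_.
    by rewrite hE (bracket0_of_killing0 c0 u0 cu by_ hE) ?linear0 // kill0.
  right; exists (c + b); split=> //; first exact: weight_vector_bracket.
  move=> w cbw; rewrite killing_invariant kill0 //.
  by have := weight_vector_bracket by_ cbw; rewrite opprD addrCA subrr addr0.
have Sr u : S u -> exists b, weight_vector b u.
  by case=> [->|[b [_ bu _]]]; [exists 0; apply: weight_vector0|exists b].
move=> a0 x0 ax; apply: contrapT => noy.
have Sx : S x.
  right; exists a; split=> // y ay; apply/eqP; apply: contraT => xy0.
  by case: noy; exists y.
suff /eqP : x = 0 by rewrite (negPf x0).
apply: (nil_ideal0 ssL _ _ _ Sx).
- by move=> u w Su /Sr[b bw]; apply: S0 bw Su.
- move=> u [->|[b [b0 bu _]]]; last exact: bracket_nilpotent b0 bu.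
  by exists 1%N => v; rewrite /= linear0 zero_lfunE.
exists r; first exact: span_basis.
by move=> u b Su /tnthP[i ->]; apply: S0 (rlam i) Su.
Qed.

End Spectrum.

(** * Roots and their reflections *)

Hypothesis ssL : lie_semisimple ad.

(** With [h = [x, y]], invariance gives [K(h, k) = a(k) K(x, y)], so that
    [h / K(x, y)] is sent to [a] by the map from [H] to its dual.  Thus the roots
    are in the image of this map, and the partial inverse used by [dual_form] has
    the expected value on them. *)
Lemma root_coroot (a : dual) : is_root ad a ->
  exists x y (h : subvs_of H), [/\ weight_vector a x, weight_vector (- a) y,
    ad x y = vsval h &
    [/\ a h != 0, 0 < dual_form ad a a &
     forall b, is_root ad b ->
       2 * dual_form ad b a / dual_form ad a a = b h *+ 2 / a h]].
Proof.
have [r [lam [rB rlam]]] := simultaneous_eigenbasis.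
have pair b x : b != 0 -> x != 0 -> weight_vector b x ->
  exists y (h : subvs_of H), [/\ weight_vector (- b) y, ad x y = vsval h,
    killing ad x y != 0 &
    forall h', killing ad (vsval h) (vsval h') = b h' * killing ad x y].
  move=> b0 x0 bx; have [y by_ xy0] := killing_opposite rB rlam ssL b0 x0 bx.
  have [h hE] := bracket_opposite bx by_; exists y, h; split=> // h'.
  rewrite -hE killing_invariant bracketC by_ opp_lfunE scaleNr opprK linearZ.
  by [].
have dualK b : is_root ad b -> forall h',
    killing ad (vsval ((killing_dual ad H)^-1%VF b)) (vsval h') = b h'.
  move=> [b0 [x x0 bx]] h'; have [y [h [_ _ xy0 hE]]] := pair _ _ b0 x0 bx.
  rewrite -killing_dualE limg_lfunVK //.
  apply/memv_imgP; exists ((killing ad x y)^-1 *: h); first exact: memvf.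
  apply/lfunP => k; rewrite linearZ /= scale_lfunE killing_dualE hE.
  by rewrite [_ *: _]mulrC mulfK.
move=> aR; have [a0 [x x0 ax]] := aR.
have [y [h [ay xyE xy0 hE]]] := pair _ _ a0 x0 ax.
have formE b : is_root ad b -> dual_form ad b a * killing ad x y = b h.
  by move=> bR; rewrite dual_formC /dual_form dualK // -hE killingC dualK.
have ah0 : a h != 0.
  apply: contraNneq xy0 => ah0; have h0 := coroot_eq0 rB rlam ssL a0 ax ay xyE ah0.
  have /existsNP[k ak] : ~ forall k, a k = 0.
    by move=> ak; case/eqP: a0; apply/lfunP => k; rewrite ak zero_lfunE.
  have := hE k; rewrite h0 killingC !linear0 => /esym/eqP.
  by rewrite mulf_eq0 => /orP[/eqP|].
exists x, y, h; split=> //; split=> //.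
  have [s s0 sE] := killing_coroot rB rlam ssL a0 x0 ax ay xyE.
  have xys : killing ad x y = s * a h.
    by apply: (mulfI ah0); rewrite -hE sE expr2 mulrCA.
  suff -> : dual_form ad a a = s^-1 by rewrite invr_gt0.
  by apply: (mulIf xy0); rewrite formE // xys mulKf ?gt_eqF.
move=> b bR; rewrite -(formE b bR) -(formE a aR) -[(_ * _) *+ 2]mulr_natl mulrA.
by rewrite -mulf_div divff // mulr1.
Qed.

Lemma root_form_gt0 (a : dual) : is_root ad a -> 0 < dual_form ad a a.
Proof. by move=> /root_coroot[x [y [h [_ _ _ []]]]]. Qed.

Lemma root_reflection (a b : dual) : is_root ad a -> is_root ad b ->
  (exists c : int, 2 * dual_form ad b a / dual_form ad a a = c%:~R) /\
  is_root ad (reflection ad a b).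
Proof.
move=> aR bR; have [r [lam [rB rlam]]] := simultaneous_eigenbasis.
have [x [y [h [ax ay xyE [ah0 _ cE]]]]] := root_coroot aR.
have [[a0 _] [b0 [v v0 bv]]] := (aR, bR).
have [c [bhE [u u0 cu]]] := reflected_weight rB rlam a0 ax ay xyE v0 bv.
have {}cE : 2 * dual_form ad b a / dual_form ad a a = c%:~R.
  by rewrite cE // bhE mulfK.
split; first by exists c.
rewrite reflectionE cE; split; last by exists u.
rewrite subr_eq0; apply: contraNneq b0 => bE.
move: bhE; rewrite bE scale_lfunE -mulr_natr => /eqP.
rewrite -subr_eq0 mulr_natr mulr2n addrK mulf_eq0 (negPf ah0) orbF => /eqP ->.
by rewrite scale0r.
Qed.

Lemma finite_roots : exists s : seq dual, forall a, is_root ad a -> a \in s.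
Proof.
have [r [lam [rB rlam]]] := simultaneous_eigenbasis.
exists (codom lam) => a [_ [x x0 ax]].
by have [i <-] := weight_in_spectrum rB rlam x0 ax; apply: codom_f.
Qed.

End Cartan.
End LieBracket.

(** * Reflections and words in real coordinates *)

Section RealRootSystem.
Variables (R : realFieldType) (n : nat) (G : 'M[R]_n).
Local Notation vec := 'cV[R]_n.
Implicit Types (u v b g : vec) (w : 'M[R]_n) (s : seq 'I_n).

Definition gram u v : R := (u^T *m G *m v) 0 0.

Definition gram_refl b : 'M[R]_n :=
  1%:M - (2 / gram b b) *: (b *m (b^T *m G)).

Definition basis_vec (i : 'I_n) : vec := delta_mx i 0.
Local Notation simple i := (gram_refl (basis_vec i)).

Definition refl_word s : 'M[R]_n := foldr (fun i w => simple i *m w) 1%:M s.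

Definition nonneg v : Prop := forall i, 0 <= v i 0.

Lemma gramZr c u v : gram u (c *: v) = c * gram u v.
Proof. by rewrite /gram -scalemxAr mxE. Qed.

Lemma gramNl u v : gram (- u) v = - gram u v.
Proof. by rewrite /gram linearN /= !mulNmx mxE. Qed.

Lemma gram_sumr I (r : seq I) (P : pred I) u (F : I -> vec) :
  gram u (\sum_(i <- r | P i) F i) = \sum_(i <- r | P i) gram u (F i).
Proof. by rewrite /gram mulmx_sumr summxE. Qed.

Lemma gram_reflE b v : gram_refl b *m v = v - (2 * gram b v / gram b b) *: b.
Proof.
rewrite mulmxBl mul1mx -scalemxAl -mulmxA; congr (_ - _).
by rewrite [_ *m v]mx11_scalar mul_mx_scalar scalerA mulrAC.
Qed.

Lemma gram_reflZ c b : c != 0 -> gram_refl (c *: b) = gram_refl b.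
Proof.
move=> c0; rewrite /gram_refl; congr (_ - _).
have -> : gram (c *: b) (c *: b) = c * c * gram b b.
  by rewrite gramZr /gram linearZ /= -!scalemxAl mxE mulrA.
rewrite -scalemxAl [(c *: b)^T]linearZ /= -scalemxAl -scalemxAr !scalerA.
congr (_ *: _); rewrite -!(mulrA _ c c) [c * c * gram b b]mulrC invfM (mulrA 2).
by rewrite mulfVK ?mulf_neq0.
Qed.

Lemma gram_reflN b : gram_refl (- b) = gram_refl b.
Proof. by rewrite -scaleN1r gram_reflZ // oppr_eq0 oner_eq0. Qed.

Lemma gram_refl_self b : gram b b != 0 -> gram_refl b *m b = - b.
Proof.
move=> bb; rewrite gram_reflE mulfK // scaler_nat mulr2n opprD addrA subrr.
by rewrite add0r.
Qed.

Lemma gram_refl_involutive b : gram b b != 0 -> gram_refl b *m gram_refl b = 1%:M.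
Proof.
move=> bb; rewrite {2}/gram_refl mulmxBr mulmx1 -scalemxAr (mulmxA (gram_refl b)).
rewrite gram_refl_self // mulNmx scalerN opprK.
by rewrite /gram_refl subrK.
Qed.

Lemma gram_refl_unit b : gram b b != 0 -> gram_refl b \in unitmx.
Proof. by move=> /gram_refl_involutive /mulmx1_unit[]. Qed.

Hypothesis GT : G^T = G.

Lemma gramC u v : gram u v = gram v u.
Proof.
rewrite /gram; have -> : v^T *m G *m u = (u^T *m G *m v)^T.
  by rewrite !trmx_mul GT trmxK mulmxA.
by rewrite [in RHS]mxE.
Qed.

Definition isometry w : Prop := w^T *m G *m w = G.

Lemma gram_isometry w u v : isometry w -> gram (w *m u) (w *m v) = gram u v.
Proof.
move=> wG; rewrite /gram trmx_mul -[in RHS]wG.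
by rewrite !mulmxA.
Qed.

Lemma isometry1 : isometry 1%:M.
Proof. by rewrite /isometry trmx1 mul1mx mulmx1. Qed.

Lemma isometryM w w' : isometry w -> isometry w' -> isometry (w *m w').
Proof.
move=> wG w'G; rewrite /isometry trmx_mul -[RHS]w'G -[in RHS]wG.
by rewrite !mulmxA.
Qed.

Lemma gram_refl_isometry b : gram b b != 0 -> isometry (gram_refl b).
Proof.
move=> bb; have rG : (gram_refl b)^T *m G = G *m gram_refl b.
  rewrite /gram_refl linearB linearZ /= trmx1 mulmxBl mulmxBr mul1mx mulmx1.
  by rewrite !trmx_mul trmxK GT -scalemxAl -scalemxAr !mulmxA.
by rewrite /isometry rG -mulmxA gram_refl_involutive // mulmx1.
Qed.

Lemma gram_refl_conj w b : isometry w ->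
  gram_refl (w *m b) *m w = w *m gram_refl b.
Proof.
move=> wG; rewrite /gram_refl gram_isometry // mulmxBl mulmxBr mul1mx mulmx1.
congr (_ - _); rewrite -scalemxAl -scalemxAr trmx_mul; congr (_ *: _).
by rewrite -!mulmxA; congr (_ *m (_ *m (_ *m _))); rewrite mulmxA.
Qed.

Variable Phi : vec -> Prop.
Hypothesis Phi_basis : forall i, Phi (basis_vec i).
Hypothesis Phi_pos : forall b, Phi b -> 0 < gram b b.
Hypothesis Phi_refl : forall b g, Phi b -> Phi g -> Phi (gram_refl b *m g).
Hypothesis Phi_sign : forall b, Phi b -> nonneg b \/ nonneg (- b).

Lemma Phi_gram_neq0 b : Phi b -> gram b b != 0.
Proof. by move=> /Phi_pos; rewrite lt0r => /andP[]. Qed.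
Hint Resolve Phi_gram_neq0 Phi_basis : core.

Lemma Phi_opp b : Phi b -> Phi (- b).
Proof. by move=> bP; rewrite -gram_refl_self ?Phi_gram_neq0 //; apply: Phi_refl. Qed.

Lemma nonneg_opp_eq0 v : nonneg v -> nonneg (- v) -> v = 0.
Proof.
move=> v0 Nv0; apply/colP => i; rewrite mxE; apply/eqP; rewrite eq_le v0 andbT.
by have := Nv0 i; rewrite mxE oppr_ge0.
Qed.

Lemma Phi_neq0 b : Phi b -> b != 0.
Proof.
by move=> /Phi_gram_neq0; apply: contraNneq => ->; rewrite /gram mulmx0 mxE.
Qed.

(** Only the coordinate [i] of [g] is changed, so any other positive coordinate
    determines the sign of the reflected root. *)
Lemma simple_refl_nonneg i g : Phi g -> nonneg g ->
  nonneg (simple i *m g) \/ exists c, g = c *: basis_vec i.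
Proof.
move=> gP g0; have [//|Ng] := Phi_sign (Phi_refl (Phi_basis i) gP); first by left.
right; exists (g i 0); apply/colP => j; rewrite !mxE eqxx andbT.
have [->|ji] := eqVneq j i; first by rewrite mulr1.
have := Ng j; rewrite gram_reflE !mxE eqxx andbT (negPf ji) !mulr0 subr0 oppr_ge0.
by move=> gj; apply/eqP; rewrite eq_le gj g0.
Qed.

Lemma refl_word_isometry s : isometry (refl_word s).
Proof.
elim: s => [|i s IH]; first exact: isometry1.
by apply: isometryM => //; apply: gram_refl_isometry; apply: Phi_gram_neq0.
Qed.

Lemma refl_word_Phi s b : Phi b -> Phi (refl_word s *m b).
Proof.
move=> bP; elim: s => [|i s IH]; first by rewrite mul1mx.
by rewrite /= -mulmxA; apply: Phi_refl.
Qed.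

(** Strong exchange property.  Reading the word from the right, there is a letter
    [i] at which the image [g] of [b] turns from positive to negative.  Then [g]
    is a multiple of the simple root [i], so the reflections in both agree, and
    moving this reflection through the rest of the word to the right turns the
    letter [i] into the reflection in [b]. *)
Lemma exchange s b : Phi b -> nonneg b -> nonneg (- (refl_word s *m b)) ->
  exists2 s', (size s' < size s)%N & refl_word s' = refl_word s *m gram_refl b.
Proof.
move=> bP b0; elim: s => [|i s IH] /=.
  rewrite mul1mx => /(nonneg_opp_eq0 b0) b00; have := Phi_neq0 bP.
  by rewrite b00 eqxx.
have [pos|/IH[s' ss' s'E] _] := Phi_sign (refl_word_Phi s bP); last first.
  by exists (i :: s'); rewrite //= s'E mulmxA.
rewrite -mulmxA => neg.
have [pos'|[c cE]] := simple_refl_nonneg i (refl_word_Phi s bP) pos.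
  have := Phi_neq0 (Phi_refl (Phi_basis i) (refl_word_Phi s bP)).
  by rewrite (nonneg_opp_eq0 pos' neg) eqxx.
have c0 : c != 0.
  have := Phi_neq0 (refl_word_Phi s bP); rewrite cE.
  by apply: contraNneq => ->; rewrite scale0r.
exists s => //; rewrite -mulmxA -gram_refl_conj; last exact: refl_word_isometry.
by rewrite cE gram_reflZ // mulmxA gram_refl_involutive ?mul1mx ?Phi_gram_neq0.
Qed.

Variable pos_roots : seq vec.
Hypothesis pos_uniq : uniq pos_roots.
Hypothesis pos_rootsP : forall b, b \in pos_roots <-> Phi b /\ nonneg b.

(** The simple reflection permutes the set [A] of positive roots that are not
    multiples of the simple root, and changes the sign of their products with
    it; these products add up to zero.  The multiples of the simple root
    contribute positive terms. *)
Lemma simple_gram_sum_ge0 i : 0 <= gram (basis_vec i) (\sum_(b <- pos_roots) b).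
Proof.
(* If [b] is a multiple of the simple root, the factor is its coordinate [i]. *)
pose mult (b : vec) := b == b i 0 *: basis_vec i.
rewrite gram_sumr (bigID mult) /= addr_ge0 //.
  rewrite big_seq_cond; apply: sumr_ge0 => b /andP[/pos_rootsP[_ b0] /eqP ->].
  by rewrite gramZr mulr_ge0 // ltW // Phi_pos.
rewrite -big_filter; set A := filter _ _.
have AP b : b \in A <-> [/\ Phi b, nonneg b & ~~ mult b].
  rewrite mem_filter; split=> [/andP[mb /pos_rootsP[]]//|[bP b0 mb]].
  by rewrite mb; apply/pos_rootsP.
have rr : gram_refl (basis_vec i) *m gram_refl (basis_vec i) = 1%:M.
  by rewrite gram_refl_involutive ?Phi_gram_neq0.
have inj : injective (mulmx (simple i) : vec -> vec).
  by apply: (can_inj (g := mulmx (simple i))) => b; rewrite mulmxA rr mul1mx.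
have stable b : b \in A -> simple i *m b \in A.
  move=> /AP[bP b0 mb]; apply/AP; split; first exact: Phi_refl.
    have [//|[c cE]] := simple_refl_nonneg i bP b0.
    by move: mb; rewrite /mult cE !mxE !eqxx mulr1 eqxx.
  apply: contra mb; rewrite /mult gram_reflE => /eqP bE; apply/eqP.
  have {}bE : b - ((2 * gram (basis_vec i) b / gram (basis_vec i) (basis_vec i)) +
      (b - (2 * gram (basis_vec i) b / gram (basis_vec i) (basis_vec i)) *:
       basis_vec i) i 0) *: basis_vec i = 0.
    by rewrite scalerDl opprD addrA {1}bE subrr.
  move/eqP: bE; rewrite subr_eq0 !mxE !eqxx mulr1 addrCA subrr addr0.
  by move=> /eqP.
have perm : perm_eq A (map (mulmx (simple i)) A).
  rewrite perm_sym; apply: uniq_perm; rewrite ?map_inj_uniq ?filter_uniq //.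
  move=> b; apply/mapP/idP => [[b' b'A ->]|bA]; first exact: stable.
  by exists (simple i *m b); rewrite ?stable // mulmxA rr mul1mx.
have anti : \sum_(b <- A) gram (basis_vec i) b = - \sum_(b <- A) gram (basis_vec i) b.
  rewrite {1}(perm_big _ perm) big_map -sumrN; apply: eq_bigr => b _.
  have iso := gram_refl_isometry (Phi_gram_neq0 (Phi_basis i)).
  rewrite -(gram_isometry _ b iso) gram_refl_self ?Phi_gram_neq0 //.
  by rewrite gramNl opprK.
by move/eqP: anti; rewrite -addr_eq0 -mulr2n mulrn_eq0 => /eqP ->.
Qed.

Definition half_sum : vec := 2^-1 *: \sum_(b <- pos_roots) b.

Lemma half_sum_gram_ge0 b : nonneg b -> 0 <= gram b half_sum.
Proof.
move=> b0; rewrite gramZr mulr_ge0 ?invr_ge0 ?ler0n // gramC.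
have -> : b = \sum_i b i 0 *: basis_vec i.
  apply/colP => j; rewrite summxE (bigD1 j) //= big1 => [|k kj].
    by rewrite !mxE !eqxx mulr1 addr0.
  by rewrite !mxE eq_sym (negPf kj) mulr0.
rewrite gram_sumr; apply: sumr_ge0 => i _; rewrite gramZr mulr_ge0 // gramC.
exact: simple_gram_sum_ge0.
Qed.

(** The difference is the multiple [2 (b, half_sum) / (b, b)] of the image of [b],
    and this image is positive since a word that sends [b] to a negative root
    could be shortened. *)
Lemma refl_step_half_sum s b : Phi b ->
    (forall s', refl_word s' = refl_word s *m gram_refl b -> (size s <= size s')%N) ->
  nonneg (refl_word s *m half_sum - refl_word s *m gram_refl b *m half_sum).
Proof.
move=> bP smin.
wlog b0 : b bP smin / nonneg b.
  move=> W; have [|Nb] := Phi_sign bP; first exact: W.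
  by rewrite -gram_reflN; apply: W => //; [apply: Phi_opp | rewrite gram_reflN].
have [pos|neg] := Phi_sign (refl_word_Phi s bP); last first.
  have [s' ss' /smin] := exchange bP b0 neg.
  by rewrite leqNgt ss'.
rewrite -mulmxA gram_reflE mulmxBr opprB addrC subrK -scalemxAr => i.
rewrite mxE mulr_ge0 // mulr_ge0 ?invr_ge0 ?(ltW (Phi_pos bP)) //.
by rewrite mulr_ge0 ?ler0n // half_sum_gram_ge0.
Qed.

End RealRootSystem.

(** * The Weyl group in simple root coordinates *)

Section Transfer.
Variables (R : realType) (L : vectType R[i]) (ad : 'Hom(L, 'End(L))).
Hypotheses (lieL : is_lie_bracket ad) (ssL : lie_semisimple ad).
Variable H : {vspace L}.
Hypothesis cartanH : cartan_subalgebra ad H.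
Variables (n : nat) (alpha : n.-tuple (dual H)).
Hypothesis simple_alpha : simple_roots ad alpha.

Definition real_comb (v : 'cV[R]_n) : dual H := \sum_i (v i 0)%:C *: tnth alpha i.

Definition simple_gram : 'M[R]_n :=
  \matrix_(i, j) complex.Re (dual_form ad (tnth alpha i) (tnth alpha j)).

Let alphaB : basis_of fullv alpha. Proof. by case: simple_alpha. Qed.
Let alpha_root i : is_root ad (tnth alpha i). Proof. by case: simple_alpha. Qed.

Lemma coord_real_comb i v : coord alpha i (real_comb v) = (v i 0)%:C.
Proof.
rewrite /real_comb; under eq_bigr do rewrite (tnth_nth 0).
exact: coord_sum_free (basis_free alphaB).
Qed.

Lemma root_vec_real_comb v : root_vec alpha (real_comb v) = v.
Proof. by apply/colP => i; rewrite mxE coord_real_comb. Qed.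

Lemma real_combB u v : real_comb (u - v) = real_comb u - real_comb v.
Proof.
rewrite /real_comb -sumrB; apply: eq_bigr => i _.
by rewrite !mxE rmorphB scalerBl.
Qed.

Lemma real_combZ c v : real_comb (c *: v) = c%:C *: real_comb v.
Proof.
rewrite /real_comb scaler_sumr; apply: eq_bigr => i _.
by rewrite mxE rmorphM scalerA.
Qed.

Lemma real_comb_basis i : real_comb (basis_vec R i) = tnth alpha i.
Proof.
rewrite /real_comb (bigD1 i) //= big1 ?addr0 => [|j ji].
  by rewrite mxE !eqxx scale1r.
by rewrite mxE (negPf ji) scale0r.
Qed.

Lemma root_signed_comb (b : dual H) : is_root ad b -> exists v,
  b = real_comb v /\ (nonneg v \/ nonneg (- v)).
Proof.
have [_ _ comb] := simple_alpha; move=> /comb[k kb].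
pose v : 'cV[R]_n := \col_i (k i)%:R.
have vE : \sum_i tnth alpha i *+ k i = real_comb v.
  by apply: eq_bigr => i _; rewrite mxE rmorph_nat scaler_nat.
have v0 : nonneg v by move=> i; rewrite mxE ler0n.
case: kb => ->; [exists v | exists (- v)]; rewrite vE.
  by split=> //; left.
split; last by right; rewrite opprK.
rewrite /real_comb -sumrN; apply: eq_bigr => i _.
by rewrite !mxE rmorphN scaleNr.
Qed.

Lemma root_vecK (b : dual H) : is_root ad b -> real_comb (root_vec alpha b) = b.
Proof. by move=> /root_signed_comb[v [-> _]]; rewrite root_vec_real_comb. Qed.

Lemma DeltaP v : Delta ad alpha v <-> is_root ad (real_comb v).
Proof.
split=> [[b /= bR <-]|vR]; first by rewrite root_vecK.
by exists (real_comb v) => //; rewrite root_vec_real_comb.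
Qed.

(** The quotient by the positive number [dual_form ad a a] is a half-integer. *)
Lemma root_form_real (a b : dual H) :
  is_root ad a -> is_root ad b -> dual_form ad b a \is Num.real.
Proof.
move=> aR bR; have aa := root_form_gt0 lieL cartanH ssL aR.
have [[c cE] _] := root_reflection lieL cartanH ssL aR bR.
have -> : dual_form ad b a = c%:~R * dual_form ad a a / 2.
  have n2 : (2 : R[i]) != 0 by rewrite pnatr_eq0.
  by rewrite -cE divfK ?gt_eqF // mulrAC divff // mul1r.
by rewrite realM ?realV ?realn // realM ?realz // gtr0_real.
Qed.

Lemma dual_form_real_comb u v :
  dual_form ad (real_comb u) (real_comb v) = (gram simple_gram u v)%:C.
Proof.
have sumr (a : dual H) (F : 'I_n -> dual H) (c : 'I_n -> R[i]) :
    dual_form ad a (\sum_i c i *: F i) = \sum_i c i * dual_form ad a (F i).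
  rewrite (big_morph _ (dual_formDr ad a) (id1 := 0)).
    by apply: eq_bigr => i _; rewrite dual_formZr.
  by have := dual_formZr ad a 0 0; rewrite scale0r mul0r.
rewrite /gram /real_comb sumr mxE rmorph_sum; apply: eq_bigr => j _.
rewrite dual_formC sumr rmorphM mulrC; congr (_ * _).
rewrite mxE rmorph_sum; apply: eq_bigr => i _.
rewrite !mxE rmorphM; congr (_ * _).
rewrite /= RRe_real; first exact: dual_formC.
exact: root_form_real.
Qed.

Lemma simple_gram_sym : simple_gram^T = simple_gram.
Proof. by apply/matrixP => i j; rewrite !mxE dual_formC. Qed.

Lemma reflection_real_comb (b : dual H) v : is_root ad b ->
  reflection ad b (real_comb v) =
  real_comb (gram_refl simple_gram (root_vec alpha b) *m v).
Proof.
move=> /root_vecK <-; rewrite root_vec_real_comb; set u := root_vec alpha b.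
have cE (x y : R) : 2 * x%:C / y%:C = (2 * x / y)%:C.
  by rewrite rmorphM fmorphV rmorphM rmorph_nat.
rewrite reflectionE gram_reflE real_combB real_combZ !dual_form_real_comb cE.
by rewrite (gramC simple_gram_sym u v).
Qed.

Lemma Delta_gram_gt0 v : Delta ad alpha v -> 0 < gram simple_gram v v.
Proof.
by move=> /DeltaP /(root_form_gt0 lieL cartanH ssL); rewrite dual_form_real_comb ltcR.
Qed.

Lemma Delta_refl u v : Delta ad alpha u -> Delta ad alpha v ->
  Delta ad alpha (gram_refl simple_gram u *m v).
Proof.
move=> /DeltaP uR /DeltaP vR; apply/DeltaP.
have [_] := root_reflection lieL cartanH ssL uR vR.
by rewrite (reflection_real_comb _ uR) root_vec_real_comb.
Qed.

Lemma Delta_sign v : Delta ad alpha v -> nonneg v \/ nonneg (- v).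
Proof.
by move=> [b /root_signed_comb[u [-> sgn]] <-]; rewrite root_vec_real_comb.
Qed.

Lemma Delta_basis i : Delta ad alpha (basis_vec R i).
Proof. by apply/DeltaP; rewrite real_comb_basis. Qed.

Lemma act_mx_uniq (w : 'End(dual H)) (M : 'M[R]_n) :
  (forall v, w (real_comb v) = real_comb (M *m v)) -> act_mx alpha w = M.
Proof.
move=> wM; apply/matrixP => i j; rewrite mxE -real_comb_basis wM.
rewrite coord_real_comb /= -[M in RHS]mulmx1 !mxE; apply: eq_bigr => k _.
by rewrite !mxE eqxx andbT eq_sym.
Qed.

(** The matrices [act_mx] keep only real parts of coordinates.  The intertwining
    identity shows that this loses nothing and that composition becomes the
    product of matrices. *)
Lemma act_mx_weyl w : weyl_group ad (H := H) w ->
  [/\ forall v, w (real_comb v) = real_comb (act_mx alpha w *m v),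
      isometry simple_gram (act_mx alpha w), act_mx alpha w \in unitmx
    & forall v, Delta ad alpha v -> Delta ad alpha (act_mx alpha w *m v)].
Proof.
elim=> [|b {}w bR _ [wE wiso wu wD]].
  have -> : act_mx alpha \1%VF = 1%:M.
    by apply: act_mx_uniq => v; rewrite id_lfunE mul1mx.
  split=> [v|||v]; rewrite ?id_lfunE ?mul1mx ?unitmx1 //.
  exact: isometry1.
have bD : Delta ad alpha (root_vec alpha b) by exists b.
have bb0 : gram simple_gram (root_vec alpha b) (root_vec alpha b) != 0.
  by rewrite gt_eqF // Delta_gram_gt0.
have E v : (reflection ad b \o w)%VF (real_comb v) =
    real_comb (gram_refl simple_gram (root_vec alpha b) *m act_mx alpha w *m v).
  by rewrite comp_lfunE wE reflection_real_comb // mulmxA.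
rewrite (act_mx_uniq E); split=> [//|||v vD].
- by apply: isometryM => //; apply: gram_refl_isometry; rewrite // simple_gram_sym.
- by rewrite unitmx_mul wu gram_refl_unit.
- by rewrite -mulmxA; apply: Delta_refl => //; apply: wD.
Qed.

Lemma simple_reflE i :
  simple_refl ad alpha i = gram_refl simple_gram (basis_vec R i).
Proof.
apply: act_mx_uniq => v; rewrite (reflection_real_comb _ (alpha_root i)).
by rewrite -real_comb_basis root_vec_real_comb.
Qed.

Lemma word_mxE s : word_mx ad alpha s = refl_word simple_gram s.
Proof. by elim: s => //= i s ->; rewrite simple_reflE. Qed.

Lemma cox_reflE t : cox_refl ad alpha t ->
  exists2 b, Delta ad alpha b & t = gram_refl simple_gram b.
Proof.
move=> [_ [w /act_mx_weyl[_ wiso wu wD] <-] [i ->]].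
exists (act_mx alpha w *m basis_vec R i); first exact/wD/Delta_basis.
by rewrite simple_reflE -gram_refl_conj // mulmxK.
Qed.

(** Finiteness of the set of roots turns the sum over a set into a sum over a
    sequence. *)
Lemma deltaE : exists2 pos : seq 'cV[R]_n,
  uniq pos /\ (forall v, v \in pos <-> Delta ad alpha v /\ nonneg v) &
  delta ad alpha = half_sum pos.
Proof.
have [s sR] := finite_roots lieL cartanH.
pose pos := [seq v <- undup [seq root_vec alpha b | b <- s] |
  `[< Delta_pos ad alpha v >]].
have posP v : v \in pos <-> Delta_pos ad alpha v.
  rewrite mem_filter mem_undup; split=> [/andP[/asboolP //]|vD].
  apply/andP; split; first exact/asboolP.
  by have [[b /sR bs <-] _] := vD; apply: map_f.
have pos_uniq : uniq pos by rewrite filter_uniq ?undup_uniq.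
exists pos; first by [].
have posE : Delta_pos ad alpha = [set` pos].
  by apply/seteqP; split=> v /=; rewrite posP.
by rewrite /delta posE -fsbig_seq.
Qed.

Lemma bruhat_step_primary_le a b :
  bruhat_step ad alpha a b -> primary_le ad alpha a b.
Proof.
move=> [_ [t /cox_reflE[g gD ->] ->] [k [l [[[s sk sa] amin] [_ bmin] kl]]]].
have [pos [pos_uniq posP] dE] := deltaE.
move=> i; rewrite /primary dE !mxE lerD2l lerN2 -subr_ge0.
have smin s' : refl_word simple_gram s' =
    refl_word simple_gram s *m gram_refl simple_gram g -> (size s <= size s')%N.
  rewrite -!word_mxE sa sk => /bmin; exact: leq_trans (ltnW kl).
have := refl_step_half_sum simple_gram_sym Delta_basis Delta_gram_gt0
  Delta_refl Delta_sign pos_uniq posP gD smin i.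
by rewrite -word_mxE sa !mxE.
Qed.

End Transfer.

Theorem theorem4p1 (R : realType) (L : vectType R[i])
    (ad : 'Hom(L, 'End(L))) (lieL : is_lie_bracket ad)
    (ssL : lie_semisimple ad)
    (H : {vspace L}) (cartanH : cartan_subalgebra ad H)
    (n : nat) (rankL : \dim H = n)
    (alpha : n.-tuple (dual H)) (simple_alpha : simple_roots ad alpha)
    (a b : 'M[R]_n) (aW : MW ad alpha a) (bW : MW ad alpha b)
    (ab : bruhat ad alpha a b) :
  primary_le ad alpha a b.
Proof.
elim: ab => [u v|u|u v w _ uv _ vw] i; first exact: bruhat_step_primary_le.
  exact: lexx.
exact: le_trans (uv i) (vw i).
Qed.
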